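(* Let $(L,Q,\mathcal{M}=Z+\mathcal{D})$ be a nonholonomic system with affine constraints whose Lagrangian does not contain gyrostatic terms, i.e. $L=T-V\circ\pi$. Let $M\subset TQ$ be the constraint manifold, and let $Y_1$ and $Y_2$ be two vector fields on $Q$. Then $E_{L,Y_1}|_M=E_{L,Y_2}|_M$ if and only if $Y_1-Y_2$ is a section of $(\mathcal{D}\oplus\langle Z\rangle)^{\perp}$.
   Context: All objects are smooth. $Q$ is an $n$-dimensional manifold, $T$ is the kinetic energy of a Riemannian metric on $Q$ (in bundle coordinates $T=\frac12\dot q\cdot A(q)\dot q$, $A$ symmetric positive definite), $V$ is a function on $Q$, and $\pi:TQ\to Q$ is the projection. $\mathcal{D}$ is a nonintegrable distribution on $Q$ of constant rank $r$, $1<r<n$, and $Z$ is a vector field on $Q$. The affine constraint distribution $\mathcal{M}=Z+\mathcal{D}$ has fibers $\mathcal{M}_q=Z(q)+\mathcal{D}_q\subset T_qQ$; the submanifold $M\subset TQ$ with fibers $\mathcal{M}_q$ is the constraint manifold. $p$ is the momentum 1-form generated by $L$ (in coordinates $p=\partial L/\partial\dot q=A(q)\dot q$), $E_L:=\langle p,\cdot\rangle-L$, and for a vector field $Y$ on $Q$, $E_{L,Y}:=E_L-\langle p,Y\rangle$, as functions on $TQ$. $\langle Z\rangle$ is the distribution generated by $Z$, so $(\mathcal{D}\oplus\langle Z\rangle)_q$ is the linear subspace of $T_qQ$ spanned by $\mathcal{D}_q$ and $Z(q)$; $\perp$ denotes the orthogonal complement with respect to the Riemannian metric defined by $T$. 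*)

(* Defs.v *)
From HB Require Import structures.
From mathcomp Require Import all_boot all_order all_algebra.
From mathcomp Require Import all_classical all_reals all_analysis.

Set Implicit Arguments.
Unset Strict Implicit.
Unset Printing Implicit Defensive.

Import Order.TTheory GRing.Theory Num.Theory numFieldNormedType.Exports.

Local Open Scope classical_set_scope.
Local Open Scope ring_scope.

Section LinearAlgebra.
Context {R : realType} {V : lmodType R}.

Definition lspan (S : set V) : set V :=
  [set v | exists (m : nat) (a : 'I_m -> R) (u : 'I_m -> V),
     (forall i, S (u i)) /\ v = \sum_i a i *: u i].

Definition lin_indep (r : nat) (X : 'I_r -> V) : Prop :=
  forall a : 'I_r -> R, \sum_i a i *: X i = 0 -> forall i, a i = 0.

Definition orth_compl (b : V -> V -> R) (S : set V) : set V :=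
  [set w | forall u, S u -> b u w = 0].

End LinearAlgebra.

(* [Cn k U f]: on the open set U, all iterated partial derivatives of f of
   order at most k exist, and those of order k are continuous. *)
Fixpoint Cn {R : realType} {d : nat} {W : normedModType R} (k : nat)
    (U : set 'rV[R]_d) (f : 'rV[R]_d -> W) : Prop :=
  match k with
  | 0%N => forall x, U x -> {for x, continuous f}
  | k'.+1 => forall i : 'I_d,
      (forall x, U x -> derivable f x (delta_mx 0 i)) /\
      Cn k' U (fun x => 'D_(delta_mx 0 i) f x)
  end.

Definition Cinfty {R : realType} {d : nat} {W : normedModType R}
    (U : set 'rV[R]_d) (f : 'rV[R]_d -> W) : Prop := forall k, Cn k U f.

(* The coordinate map and its inverse are total functions, meaningful only on
   [chart_dom] and on its image respectively. *)
Record chart (R : realType) (n : nat) (Q : topologicalType) := Chart {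
  chart_dom : set Q;
  coord : Q -> 'rV[R]_n;
  param : 'rV[R]_n -> Q;
  chart_dom_open : open chart_dom;
  chart_img_open : open (coord @` chart_dom);
  coordK : forall q, chart_dom q -> param (coord q) = q;
  coord_continuous : forall q, chart_dom q -> {for q, continuous coord};
  param_continuous :
    forall x, (coord @` chart_dom) x -> {for x, continuous param} }.

Record manifold (R : realType) (n : nat) := Manifold {
  carrier :> topologicalType;
  carrier_hausdorff : hausdorff_space carrier;
  carrier_second_countable : @second_countable carrier;
  atlas : set (chart R n carrier);
  atlas_cover : forall q : carrier, exists2 c, atlas c & chart_dom c q;
  atlas_compat : forall c c', atlas c -> atlas c' ->
    Cinfty (coord c @` (chart_dom c `&` chart_dom c'))
           (coord c' \o param c) }.

Section Manifold.
Context {R : realType} {n : nat} {Q : manifold R n}.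

Definition smooth_on (W : set Q) (f : Q -> R) : Prop :=
  forall c, atlas c -> Cinfty (coord c @` (chart_dom c `&` W)) (f \o param c).

Definition smooth (f : Q -> R) : Prop := smooth_on setT f.

Definition smooth_param (d : nat) (W : set 'rV[R]_d) (s : 'rV[R]_d -> Q) :=
  (forall x, W x -> {for x, continuous s}) /\
  forall c : chart R n Q, atlas c ->
    Cinfty (W `&` s @^-1` chart_dom c) (coord c \o s).

(* Tangent vectors at q are the derivations at q of the algebra of smooth
   functions.  They are represented as functionals on all functions, with the
   value 0 on the nonsmooth ones, so that equality of tangent vectors is
   equality of derivations. *)
Definition derivation_at (q : Q) : set ((Q -> R) -> R^o) :=
  [set v | [/\ forall f, ~ smooth f -> v f = 0,
     forall (a : R) f g, smooth f -> smooth g ->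
       v (fun x => a * f x + g x) = a * v f + v g &
     forall f g, smooth f -> smooth g ->
       v (fun x => f x * g x) = f q * v g + v f * g q]].

Definition derivation_pred (q : Q) : {pred ((Q -> R) -> R^o)} :=
  mem (derivation_at q).

Lemma derivation_submod_closed (q : Q) : submod_closed (derivation_pred q).
Proof.
split=> [|b v w].
  apply: mem_set; split=> // [a f g _ _|f g _ _].
    by rewrite mulr0 addr0.
  by rewrite mulr0 mul0r addr0.
move=> /set_mem[v0 vD vM] /set_mem[w0 wD wM]; apply: mem_set; split.
- by move=> f Nf; rewrite !fctE v0// w0// scaler0 addr0.
- move=> a f g sf sg; rewrite !fctE vD// wD//.
  by rewrite /GRing.scale/= !mulrDr addrACA mulrCA.
- move=> f g sf sg; rewrite !fctE vM// wM//.
  by rewrite /GRing.scale/= !mulrDr mulrDl addrACA (mulrCA b) (mulrA b).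
Qed.

HB.instance Definition _ (q : Q) :=
  GRing.isSubmodClosed.Build _ _ (derivation_pred q)
    (derivation_submod_closed q).

Record tangent (q : Q) := Tangent {
  tangent_fun :> (Q -> R) -> R^o;
  tangentP : tangent_fun \in derivation_pred q }.

HB.instance Definition _ (q : Q) := [isSub for @tangent_fun q].
HB.instance Definition _ (q : Q) := [Choice of tangent q by <:].
HB.instance Definition _ (q : Q) := [SubChoice_isSubLmodule of tangent q by <:].

Definition vector_field := forall q : Q, tangent q.

(* Values on global smooth functions suffice: by bump functions they determine
   the components of X in every chart near each point of W. *)
Definition smooth_field_on (W : set Q) (X : vector_field) : Prop :=
  forall f, smooth f -> smooth_on W (fun q => X q f).

Definition smooth_field (X : vector_field) : Prop := smooth_field_on setT X.

Definition tangent_distribution := forall q : Q, set (tangent q).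

Definition section_of (Y : vector_field) (E : tangent_distribution) : Prop :=
  forall q, E q (Y q).

Definition smooth_distribution (r : nat) (D : tangent_distribution) : Prop :=
  forall q0 : Q, exists (W : set Q) (X : 'I_r -> vector_field),
    [/\ open W, W q0, forall i, smooth_field_on W (X i) &
        forall q, W q -> lin_indep (fun i => X i q) /\
                         D q = lspan (range (fun i => X i q))].

(* The image of the differential of s at x. *)
Definition tangent_image (d : nat) (s : 'rV[R]_d -> Q) (x : 'rV[R]_d) :
    set (tangent (s x)) :=
  [set v | exists w, forall f : Q -> R, smooth f -> v f = 'D_w (f \o s) x].
Arguments tangent_image {d} s x.

(* Integrability of a distribution of rank r: through every point there passes
   an integral manifold, here given by a local parametrization, which is
   an immersion because the image of its differential has dimension r. *)
Definition integrable_distribution (r : nat) (D : tangent_distribution) : Prop :=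
  forall q0 : Q, exists (W : set 'rV[R]_r) (s : 'rV[R]_r -> Q),
    [/\ open W, W 0, smooth_param W s, s 0 = q0 &
        forall x, W x -> tangent_image s x = D (s x)].

Record riemannian_metric := RiemannianMetric {
  riemannian_form :> forall q : Q, tangent q -> tangent q -> R;
  riemannian_linear : forall q (a : R) (u v w : tangent q),
    riemannian_form (a *: u + v) w =
    a * riemannian_form u w + riemannian_form v w;
  riemannian_sym : forall q (u v : tangent q),
    riemannian_form u v = riemannian_form v u;
  riemannian_pos : forall q (u : tangent q),
    u != 0 -> 0 < riemannian_form u u;
  riemannian_smooth : forall X Y : vector_field,
    smooth_field X -> smooth_field Y ->
    smooth (fun q => riemannian_form (X q) (Y q)) }.

Definition tangent_bundle := {q : Q & tangent q}.

Definition bundle_proj (v : tangent_bundle) : Q := projT1 v.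

Definition kinetic_energy (g : riemannian_metric) (v : tangent_bundle) : R :=
  2^-1 * g (projT1 v) (projT2 v) (projT2 v).

(* <p(v), w>, where p is the fiber derivative of L *)
Definition momentum (L : tangent_bundle -> R) (v : tangent_bundle)
    (w : tangent (bundle_proj v)) : R :=
  derive1 (fun t : R => L (existT _ (projT1 v) (projT2 v + t *: w))) 0.
Arguments momentum : clear implicits.

Definition energy (L : tangent_bundle -> R) (v : tangent_bundle) : R :=
  momentum L v (projT2 v) - L v.

Definition moving_energy (L : tangent_bundle -> R) (Y : vector_field)
    (v : tangent_bundle) : R :=
  energy L v - momentum L v (Y (bundle_proj v)).

Definition affine_distribution (Z : vector_field)
    (D : tangent_distribution) : tangent_distribution :=
  fun q => [set Z q + u | u in D q].

Definition constraint_manifold (A : tangent_distribution) : set tangent_bundle :=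
  [set v | A (projT1 v) (projT2 v)].

Definition join_field (D : tangent_distribution) (Z : vector_field) :
    tangent_distribution :=
  fun q => lspan (D q `|` [set Z q]).

Definition orth_distribution (g : riemannian_metric) (E : tangent_distribution) :
    tangent_distribution :=
  fun q => orth_compl (g q) (E q).

End Manifold.

Arguments vector_field {R n} Q.
Arguments tangent_distribution {R n} Q.
Arguments riemannian_metric {R n} Q.
Arguments tangent_bundle {R n} Q.
Arguments momentum {R n Q} L v w.

(* Main.v *)
Require Import Defs.
From mathcomp Require Import all_boot all_order all_algebra.
From mathcomp Require Import all_classical all_reals all_analysis.
From mathcomp Require Import ring.

Import Order.TTheory GRing.Theory Num.Theory numFieldNormedType.Exports.

Local Open Scope classical_set_scope.
Local Open Scope ring_scope.

(** Without gyrostatic terms the Legendre transform is the metric itself: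
    [L] restricted to the line [v + t w] is a quadratic polynomial in [t] whose
    linear coefficient is [g v w], so [<p(v), w> = g v w]
    ([momentum_natural]).  The energy is common to both moving energies, which
    therefore agree at [v] exactly when [v] is orthogonal to
    [y = Y1 - Y2] ([moving_energy_eqP]).

    What remains is fiberwise linear algebra: [y] is orthogonal to the affine
    subspace [Z + D] iff it is orthogonal to the linear subspace spanned by [D]
    and [Z].  Since [0] lies in [D], the point [Z] lies in the affine subspace;
    subtracting it shows that [D] is orthogonal to [y] as well
    ([orth_affineP]). *)

Section LinearAlgebra.
Context {R : realType} {V : lmodType R}.

Lemma lspan_sub (S : set V) : S `<=` lspan S.
Proof.
move=> u Su; exists 1%N, (fun=> 1), (fun=> u); split=> //.
by rewrite big_ord1 scale1r.
Qed.

Lemma lspan0 (S : set V) : lspan S 0.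
Proof. by exists 0%N, (fun=> 0), (fun=> 0); rewrite big_ord0; split=> [[]|]. Qed.

Lemma orth_compl_lspan (b : V -> V -> R) (S : set V) :
  (forall a u v w, b (a *: u + v) w = a * b u w + b v w) ->
  orth_compl b (lspan S) = orth_compl b S.
Proof.
move=> bl; apply/seteqP; split=> w Sw u; first by move/lspan_sub/Sw.
have b0 : b 0 w = 0.
  by have := bl (-1) 0 0 w; rewrite scaler0 addr0 mulN1r addNr.
move=> [m [a [e [Se ->]]]]; elim/big_ind : _ => [//|x y bx by_|i _].
  by rewrite -[x]scale1r bl bx by_ mulr0 addr0.
by rewrite -[_ *: _]addr0 bl b0 (Sw _ (Se i)) mulr0 addr0.
Qed.

(** The affine subspace [z + S] passes through [z] because [S] passes through
    [0]; so [y] is orthogonal to [z], hence by differences to all of [S]. *)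
Lemma orth_affineP (b : V -> V -> R) (S : set V) (z y : V) :
  (forall a u v w, b (a *: u + v) w = a * b u w + b v w) -> S 0 ->
  (forall u, S u -> b (z + u) y = 0) <->
  orth_compl b (lspan (S `|` [set z])) y.
Proof.
move=> bl S0; rewrite orth_compl_lspan//.
have bD u v : b (u + v) y = b u y + b v y by rewrite -[u]scale1r bl mul1r scale1r.
split=> [H|H u Su]; last by rewrite bD !H ?addr0; [|left|right].
have zy : b z y = 0 by rewrite -[z]addr0 H.
by move=> u [Su|->//]; have := H u Su; rewrite bD zy add0r.
Qed.

End LinearAlgebra.

Lemma derive1_quadratic0 {R : realType} (a b c : R) :
  derive1 (fun t : R => a + t * b + t ^+ 2 * c) 0 = b.
Proof.
have H : is_derive (0 : R) 1 (fun t : R => a + t * b + t ^+ 2 * c) b.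
  by apply: is_derive_eq; rewrite /GRing.scale/= ; ring.
by rewrite derive1E derive_val.
Qed.

Section MovingEnergy.
Context {R : realType} {n : nat} {Q : manifold R n}.

Lemma smooth_distribution0 {r : nat} {D : tangent_distribution Q} (q : Q) :
  smooth_distribution r D -> D q 0.
Proof.
by move=> /(_ q)[W [X [_ Wq _ /(_ _ Wq)[_ ->]]]]; exact: lspan0.
Qed.

Variables (g : riemannian_metric Q) (V : Q -> R).

Let L (v : tangent_bundle Q) := kinetic_energy g v - V (bundle_proj v).

Lemma riemannianBr q (u v w : tangent q) : g q u (v - w) = g q u v - g q u w.
Proof.
rewrite addrC -scaleN1r riemannian_sym riemannian_linear !(riemannian_sym g _ u).
by rewrite mulN1r addrC.
Qed.

Lemma riemannian_line q (u v : tangent q) (t : R) :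
  g q (u + t *: v) (u + t *: v) = g q u u + t * g q u v *+ 2 + t ^+ 2 * g q v v.
Proof.
rewrite addrC riemannian_linear 2!(riemannian_sym g _ (t *: v + u)).
by rewrite !riemannian_linear (riemannian_sym g v u); ring.
Qed.

(** The potential depends on the base point only, so along the fiber
    [L] is a quadratic polynomial with linear coefficient [g v w]. *)
Lemma momentum_natural (v : tangent_bundle Q) (w : tangent (bundle_proj v)) :
  momentum L v w = g _ (projT2 v) w.
Proof.
rewrite /momentum -[RHS](derive1_quadratic0 (L v) _ (2^-1 * g _ w w)).
congr (derive1 _ 0); apply/funext => t.
by rewrite /L /kinetic_energy/= riemannian_line; field.
Qed.

Lemma moving_energy_eqP (Y1 Y2 : vector_field Q) (v : tangent_bundle Q) :
  moving_energy L Y1 v = moving_energy L Y2 v <->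
  g _ (projT2 v) (Y1 (projT1 v) - Y2 (projT1 v)) = 0.
Proof.
rewrite /moving_energy !momentum_natural riemannianBr /bundle_proj.
by split=> [/addrI/oppr_inj ->|/subr0_eq ->//]; rewrite subrr.
Qed.

End MovingEnergy.

Theorem proposition7 (R : realType) (n r : nat) (Q : manifold R n)
    (g : riemannian_metric Q) (V : Q -> R) (L : tangent_bundle Q -> R)
    (D : tangent_distribution Q) (Z Y1 Y2 : vector_field Q)
    (hr : (1 < r < n)%N)
    (hV : smooth V)
    (hL : L = fun v => kinetic_energy g v - V (bundle_proj v))
    (hD : smooth_distribution r D)
    (hDn : ~ integrable_distribution r D)
    (hZ : smooth_field Z) (hY1 : smooth_field Y1) (hY2 : smooth_field Y2) :
  {in constraint_manifold (affine_distribution Z D),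
     moving_energy L Y1 =1 moving_energy L Y2} <->
  section_of (fun q => Y1 q - Y2 q) (orth_distribution g (join_field D Z)).
Proof.
have fiberP q := orth_affineP (g q) (D q) (Z q) (Y1 q - Y2 q)
  (riemannian_linear g (q := q)) (smooth_distribution0 q hD).
rewrite hL; split=> [H q|H [q v] /set_mem[u Du /= <-]].
- apply/fiberP => u Du.
  apply: (iffLR (moving_energy_eqP g V Y1 Y2 (existT _ q (Z q + u)))).
  by apply: H; apply: mem_set; exists u.
- by apply/moving_energy_eqP; move/fiberP: (H q); apply.
Qed.
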